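(* Let $R,C\ge 1$ be integers, let $\mathcal{I}=\{(i,j)\mid 1\le i\le R,\ 1\le j\le C\}$, and let $S_1,\ldots,S_N$ ($N\ge 1$) be rectangles of $\mathcal{I}$ with $S_1\subset S_2\subset\cdots\subset S_N\subset\mathcal{I}$. Then the set of basic moves belonging to $\mathcal{M}_{S_1,\ldots,S_N}$ is the unique minimal Markov basis for the configuration $A_{S_1,\ldots,S_N}$.
   Context: Let $\mathbb{N}=\{0,1,2,\ldots\}$. An $R\times C$ contingency table is $\mathbf{x}=(x_{ij})_{(i,j)\in\mathcal{I}}$ with $x_{ij}\in\mathbb{N}$, regarded as a column vector. The symbol $\subset$ denotes proper inclusion. A subset $S\subseteq\mathcal{I}$ is a rectangle in $\mathcal{I}$ if $S=\{(i,j)\mid a_1\le i\le a_2,\ b_1\le j\le b_2\}$ for some $1\le a_1<a_2\le R$ and $1\le b_1<b_2\le C$. For subsets $S_1,\ldots,S_N\subseteq\mathcal{I}$, the configuration $A_{S_1,\ldots,S_N}$ is the zero-one matrix with $A_{S_1,\ldots,S_N}\mathbf{x}=(x_{1+},\ldots,x_{R+},x_{+1},\ldots,x_{+C},x_{S_1},\ldots,x_{S_N})'$, where $x_{i+}=\sum_{j=1}^{C}x_{ij}$, $x_{+j}=\sum_{i=1}^{R}x_{ij}$ and $x_{S_n}=\sum_{(i,j)\in S_n}x_{ij}$. For such a matrix $A$ and an integer vector $\mathbf{t}$, the $\mathbf{t}$-fiber is $\mathcal{F}_{\mathbf{t}}=\{\mathbf{x}\in\mathbb{N}^{\mathcal{I}}\mid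 A\mathbf{x}=\mathbf{t}\}$. A move for $A$ is an integer table $\mathbf{z}\in\mathbb{Z}^{\mathcal{I}}$ with $A\mathbf{z}=0$. The set of moves for $A_{S_1,\ldots,S_N}$ is denoted $\mathcal{M}_{S_1,\ldots,S_N}$. A basic move is an integer table with entries $+1$ at $(i,j)$ and $(i',j')$, entries $-1$ at $(i',j)$ and $(i,j')$, and $0$ elsewhere, for some $i\ne i'$ and $j\ne j'$. A set $\mathcal{B}$ of moves is sign-invariant if $\mathbf{z}\in\mathcal{B}$ implies $-\mathbf{z}\in\mathcal{B}$. A sign-invariant finite set $\mathcal{B}$ of moves for $A$ is a Markov basis for $A$ if for every $\mathbf{t}$ and all $\mathbf{x}\ne\mathbf{y}$ in $\mathcal{F}_{\mathbf{t}}$ there exist $U>0$ and $\mathbf{z}_1,\ldots,\mathbf{z}_U\in\mathcal{B}$ (repetitions allowed) such that $\mathbf{y}=\mathbf{x}+\sum_{s=1}^{U}\mathbf{z}_s$ and $\mathbf{x}+\sum_{s=1}^{u}\mathbf{z}_s\in\mathcal{F}_{\mathbf{t}}$ for $1\le u\le U$. Only sign-invariant sets are considered as Markov bases. A Markov basis is minimal if no proper sign-invariant subset of it is a Markov basis. *)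

(* Defs.v *)
From mathcomp Require Import all_boot all_order all_algebra.
From mathcomp Require Import classical_sets cardinality.

Set Implicit Arguments.
Unset Strict Implicit.
Unset Printing Implicit Defensive.

Import Order.TTheory GRing.Theory Num.Theory.
Local Open Scope ring_scope.

(* Tables are R x C integer matrices with 0-based indices; contingency tables
   are those with entries in Num.nat.  Configurations act on the row-major
   column vector of a table. *)
Definition tvec (R C : nat) (x : 'M[int]_(R, C)) : 'cV[int]_(R * C) :=
  (mxvec x)^T.

Definition rectangle (R C : nat) (S : {set 'I_R * 'I_C}) : Prop :=
  exists (a1 a2 : 'I_R) (b1 b2 : 'I_C),
    [/\ (a1 < a2)%N, (b1 < b2)%N &
        S = [set p : 'I_R * 'I_C |
              (a1 <= p.1 <= a2)%N && (b1 <= p.2 <= b2)%N]%SET].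

Definition indicator_table (R C : nat) (S : {set 'I_R * 'I_C}) :
    'M[int]_(R, C) :=
  \matrix_(i, j) ((i, j) \in S)%:R.

(* Stacks the vectorized indicators of the rows, of the columns and of the
   S n; configE below computes its action on tables. *)
Definition config (R C N : nat) (S : 'I_N -> {set 'I_R * 'I_C}) :
    'M[int]_(R + C + N, R * C) :=
  col_mx
    (col_mx
       (\matrix_(i < R)
          mxvec (indicator_table [set p : 'I_R * 'I_C | p.1 == i]%SET))
       (\matrix_(j < C)
          mxvec (indicator_table [set p : 'I_R * 'I_C | p.2 == j]%SET)))
    (\matrix_(n < N) mxvec (indicator_table (S n))).

Lemma mxvec_indicator_tvec (R C : nat) (S : {set 'I_R * 'I_C})
    (x : 'M[int]_(R, C)) (i j : 'I_1) :
  (mxvec (indicator_table S) *m tvec x) i j = \sum_(p in S) x p.1 p.2.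
Proof.
rewrite mxE (reindex _ (curry_mxvec_bij _ _)) /= [RHS]big_mkcond /=.
apply: eq_bigr => -[k l] _; rewrite !ord1 [tvec x _ _]mxE !mxvecE mxE.
by case: ifP => _; rewrite ?mul1r ?mul0r.
Qed.

Lemma configE (R C N : nat) (S : 'I_N -> {set 'I_R * 'I_C})
    (x : 'M[int]_(R, C)) :
  config S *m tvec x =
    col_mx (col_mx (\col_(i < R) \sum_(j < C) x i j)
                   (\col_(j < C) \sum_(i < R) x i j))
           (\col_(n < N) \sum_(p in S n) x p.1 p.2).
Proof.
have rowE m (F : 'I_m -> {set 'I_R * 'I_C}) :
    (\matrix_(k < m) mxvec (indicator_table (F k))) *m tvec x =
    \col_(k < m) \sum_(p in F k) x p.1 p.2.
  apply/matrixP=> k o; rewrite [RHS]mxE -(mxvec_indicator_tvec _ _ 0 o) !mxE.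
  by apply: eq_bigr => l _; rewrite [X in X * _]mxE.
rewrite /config !mul_col_mx !rowE.
congr (col_mx (col_mx _ _) _); apply/matrixP=> k o; rewrite !mxE.
- rewrite (eq_bigl (fun p => (p.1 == k) && true)) => [|p]; last first.
    by rewrite inE andbT.
  by rewrite -(pair_big (pred1 k) predT (fun i j => x i j)) /= big_pred1_eq.
- rewrite (eq_bigl (fun p => true && (p.2 == k))) => [|p]; last by rewrite inE.
  rewrite -(pair_big predT (pred1 k) (fun i j => x i j)) /=.
  by apply: eq_bigr => i _; rewrite big_pred1_eq.
Qed.

Definition fiber (R C m : nat) (A : 'M[int]_(m, R * C)) (t : 'cV[int]_m) :
    set 'M[int]_(R, C) :=
  [set x | x \is a mxOver Num.nat /\ A *m tvec x = t]%classic.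

Definition moves (R C m : nat) (A : 'M[int]_(m, R * C)) :
    set 'M[int]_(R, C) :=
  [set z | A *m tvec z = 0]%classic.

Definition basic_moves (R C : nat) : set 'M[int]_(R, C) :=
  [set z | exists (i i' : 'I_R) (j j' : 'I_C),
     [/\ i != i', j != j' &
         z = delta_mx i j + delta_mx i' j'
             - delta_mx i' j - delta_mx i j']]%classic.

Definition sign_invariant (R C : nat) (B : set 'M[int]_(R, C)) : Prop :=
  forall z, B z -> B (- z).

Definition markov_basis (R C m : nat) (A : 'M[int]_(m, R * C))
    (B : set 'M[int]_(R, C)) : Prop :=
  [/\ (B `<=` moves A)%classic, finite_set B, sign_invariant B &
      forall (t : 'cV[int]_m) (x y : 'M[int]_(R, C)),
        fiber A t x -> fiber A t y -> x <> y ->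
        exists (U : nat) (z : nat -> 'M[int]_(R, C)),
          [/\ (0 < U)%N,
              forall s, (1 <= s <= U)%N -> B (z s),
              y = x + \sum_(1 <= s < U.+1) z s &
              forall u, (1 <= u <= U)%N ->
                fiber A t (x + \sum_(1 <= s < u.+1) z s)]].

Definition minimal_markov_basis (R C m : nat) (A : 'M[int]_(m, R * C))
    (B : set 'M[int]_(R, C)) : Prop :=
  markov_basis A B /\
  forall B' : set 'M[int]_(R, C),
    (B' `<` B)%classic -> sign_invariant B' -> ~ markov_basis A B'.

(* Main.v *)
Require Import Defs.
From mathcomp Require Import all_boot all_order all_algebra.
From mathcomp Require Import classical_sets cardinality.
From mathcomp Require Import boolp zify ring.

(** Record nestedness by levels: cell (i, j) lies in S n iff r i <= n and
    c j <= n.  The basic move on rows i, i' and columns j, j' is then a move iff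
    no n separates both r i from r i' and c j from c j'.  Order rows and columns
    by level, ties broken by index, and apply the available basic moves only in
    the direction (i, j), (i', j') -> (i, j'), (i', j) for i < i', j < j'.  This
    decreases the sum of key(i) * key(j) * x i j, so every table reaches a
    reduced one.  Reduced tables are unique in their fiber: if no cell of an
    upper left and no cell of a lower right quadrant can both be positive, one
    of these quadrants vanishes and the sum over the upper right one is the
    smaller of two sums already known.  This determines first the sums over
    initial segments of levels, then those over initial rows and initial
    levels of columns, and finally those over initial rows and columns.

    Conversely the fiber of the positive part of a basic move has exactly two
    elements, so every Markov basis contains every basic move of the
    configuration. *)

Import Order.TTheory GRing.Theory Num.Theory.
Local Open Scope ring_scope.

Set Implicit Arguments.
Unset Strict Implicit.
Unset Printing Implicit Defensive.

(** * Weighted sums and block sums of tables *)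

Definition wsum (R C : nat) (z : 'M[int]_(R, C)) (w : 'I_R -> 'I_C -> int) :
    int :=
  \sum_i \sum_j z i j * w i j.

(** Block sums are weighted sums, as are the sums over the sets [S n] and the weight that reduction
    decreases, so linearity is proved once for all of them. *)
Definition bsum (R C : nat) (z : 'M[int]_(R, C)) (P : pred 'I_R)
    (Q : pred 'I_C) : int :=
  wsum z (fun i j => (P i && Q j)%:R).

Lemma eq_wsum (R C : nat) (z : 'M[int]_(R, C)) (w w' : 'I_R -> 'I_C -> int) :
  (forall i j, w i j = w' i j) -> wsum z w = wsum z w'.
Proof.
by move=> ww'; apply: eq_bigr => i _; apply: eq_bigr => j _; rewrite ww'.
Qed.

Lemma wsumD (R C : nat) (x y : 'M[int]_(R, C)) w :
  wsum (x + y) w = wsum x w + wsum y w.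
Proof.
rewrite -big_split; apply: eq_bigr => i _; rewrite -big_split.
by apply: eq_bigr => j _; rewrite mxE mulrDl.
Qed.

Lemma wsumN (R C : nat) (x : 'M[int]_(R, C)) w : wsum (- x) w = - wsum x w.
Proof.
rewrite -sumrN; apply: eq_bigr => i _; rewrite -sumrN.
by apply: eq_bigr => j _; rewrite mxE mulNr.
Qed.

Lemma wsum_addr (R C : nat) (x : 'M[int]_(R, C)) w w' :
  wsum x w + wsum x w' = wsum x (fun i j => w i j + w' i j).
Proof.
rewrite -big_split; apply: eq_bigr => i _; rewrite -big_split.
by apply: eq_bigr => j _; rewrite mulrDr.
Qed.

Lemma wsum_delta (R C : nat) (i : 'I_R) (j : 'I_C) w :
  wsum (delta_mx i j) w = w i j.
Proof.
rewrite /wsum (bigD1 i) //= (bigD1 j) //= mxE !eqxx mul1r.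
rewrite big1 ?addr0 => [|l /negPf jl]; last by rewrite mxE jl andbF mul0r.
rewrite big1 ?addr0 // => k /negPf ik.
by rewrite big1 // => l _; rewrite mxE ik mul0r.
Qed.

Lemma wsum_tr (R C : nat) (x : 'M[int]_(R, C)) w :
  wsum x^T w = wsum x (fun i j => w j i).
Proof.
rewrite /wsum exchange_big; apply: eq_bigr => i _; apply: eq_bigr => j _.
by rewrite mxE.
Qed.

Lemma bsumD (R C : nat) (x y : 'M[int]_(R, C)) P Q :
  bsum (x + y) P Q = bsum x P Q + bsum y P Q.
Proof. exact: wsumD. Qed.

Lemma bsumB (R C : nat) (x y : 'M[int]_(R, C)) P Q :
  bsum (x - y) P Q = bsum x P Q - bsum y P Q.
Proof. by rewrite bsumD /bsum wsumN. Qed.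

Lemma eq_bsum (R C : nat) (z : 'M[int]_(R, C)) P Q P' Q' :
  (forall i j, P i && Q j = P' i && Q' j) -> bsum z P Q = bsum z P' Q'.
Proof. by move=> PQ; apply: eq_wsum => i j; rewrite PQ. Qed.

(** The hypothesis splits a block into two disjoint blocks; as an equation between numbers it covers
    disjointness and union at once and is within reach of [lia]. *)
Lemma bsum_split (R C : nat) (z : 'M[int]_(R, C)) P Q P1 Q1 P2 Q2 :
  (forall i j, (P i && Q j : nat) = ((P1 i && Q1 j) + (P2 i && Q2 j))%N) ->
  bsum z P Q = bsum z P1 Q1 + bsum z P2 Q2.
Proof.
by move=> PQ; rewrite /bsum wsum_addr; apply: eq_wsum => i j; rewrite PQ natrD.
Qed.

Lemma bsum_tr (R C : nat) (x : 'M[int]_(R, C)) P Q :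
  bsum x^T P Q = bsum x Q P.
Proof. by rewrite /bsum wsum_tr; apply: eq_wsum => i j; rewrite andbC. Qed.

Lemma bsum_pred1 (R C : nat) (x : 'M[int]_(R, C)) i j :
  bsum x (pred1 i) (pred1 j) = x i j.
Proof.
rewrite /bsum /wsum (bigD1 i) //= (bigD1 j) //= !eqxx mulr1.
rewrite big1 ?addr0 => [|l /negPf ->]; last by rewrite andbF mulr0.
rewrite big1 ?addr0 // => k /negPf ik.
by rewrite big1 // => l _; rewrite ik mulr0.
Qed.

Lemma bsum_ge0 (R C : nat) (x : 'M[int]_(R, C)) P Q :
  x \is a mxOver Num.nat -> 0 <= bsum x P Q.
Proof.
move=> /mxOverP x0; apply: sumr_ge0 => i _; apply: sumr_ge0 => j _.
by apply: mulr_ge0; rewrite // -Znat_def.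
Qed.

Lemma bsum_eq0_or_pos (R C : nat) (x : 'M[int]_(R, C)) P Q :
  bsum x P Q = 0 \/
  exists i j, [/\ P i, Q j & x i j != 0].
Proof.
have [|ne0] := EM (exists i j, [/\ P i, Q j & x i j != 0]); [by right | left].
apply: big1 => i _; apply: big1 => j _.
have [Pi|] := boolP (P i); last by rewrite mulr0.
have [Qj|] := boolP (Q j); last by rewrite mulr0.
have [-> |xij] := eqVneq (x i j) 0; first by rewrite mul0r.
by case: ne0; exists i, j.
Qed.

(** * Basic moves, moves of the configuration and fibers *)

Definition basic_move (R C : nat) (i i' : 'I_R) (j j' : 'I_C) :
    'M[int]_(R, C) :=
  delta_mx i j + delta_mx i' j' - delta_mx i' j - delta_mx i j'.

Lemma wsum_basic_move (R C : nat) (i i' : 'I_R) (j j' : 'I_C) w :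
  wsum (basic_move i i' j j') w = w i j + w i' j' - w i' j - w i j'.
Proof. by rewrite !wsumD !wsumN !wsum_delta. Qed.

Lemma movesP (R C N : nat) (S : 'I_N -> {set 'I_R * 'I_C})
    (z : 'M[int]_(R, C)) :
  moves (config S) z <->
  [/\ forall P, bsum z P predT = 0, forall Q, bsum z predT Q = 0 &
      forall n, wsum z (fun i j => ((i, j) \in S n)%:R) = 0].
Proof.
have sumS n : wsum z (fun i j => ((i, j) \in S n)%:R) =
    \sum_(p in S n) z p.1 p.2.
  rewrite /wsum pair_big [RHS]big_mkcond; apply: eq_bigr => -[k l] _ /=.
  by case: ifP; rewrite ?mulr1 ?mulr0.
have sumr P : bsum z P predT = \sum_(i | P i) \sum_j z i j.
  rewrite [RHS]big_mkcond; apply: eq_bigr => i _; rewrite -[RHS]mulr1.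
  case: ifP => _; last by rewrite big1 ?mul0r // => j; rewrite mulr0.
  by rewrite mulr1; apply: eq_bigr => j; rewrite mulr1.
have sumc Q : bsum z predT Q = \sum_(j | Q j) \sum_i z i j.
  rewrite [RHS]big_mkcond /bsum /wsum exchange_big /=; apply: eq_bigr => j _.
  case: ifP => _; last by rewrite big1 // => i; rewrite mulr0.
  by apply: eq_bigr => i; rewrite mulr1.
rewrite /moves /= configE; split.
  move=> e0; have er := congr1 (usubmx \o usubmx) e0.
  have ec := congr1 (dsubmx \o usubmx) e0; have eS := congr1 dsubmx e0.
  rewrite /= !col_mxKu in er; rewrite /= col_mxKu col_mxKd in ec.
  rewrite col_mxKd in eS.
  split=> [P|Q|n].
  - rewrite sumr big1 // => i _.
    by have /matrixP/(_ i 0) := er; rewrite !mxE.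
  - rewrite sumc big1 // => j _.
    by have /matrixP/(_ j 0) := ec; rewrite !mxE.
  - by rewrite sumS; have /matrixP/(_ n 0) := eS; rewrite !mxE.
move=> [er ec eS]; apply/matrixP => k o; rewrite !mxE.
case: (split k) => k'; rewrite !mxE; last by rewrite -sumS eS.
case: (split k') => l; rewrite !mxE.
- by have := er (pred1 l); rewrite sumr big_pred1_eq.
- by have := ec (pred1 l); rewrite sumc big_pred1_eq.
Qed.

Lemma tvecD (R C : nat) (x y : 'M[int]_(R, C)) :
  tvec (x + y) = tvec x + tvec y.
Proof. by rewrite /tvec !raddfD. Qed.

Lemma tvecB (R C : nat) (x y : 'M[int]_(R, C)) :
  tvec (x - y) = tvec x - tvec y.
Proof. by rewrite /tvec !raddfB. Qed.

Lemma movesN (R C m : nat) (A : 'M[int]_(m, R * C)) z :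
  moves A z -> moves A (- z).
Proof.
by rewrite /moves /= /tvec !raddfN /= => /eqP; rewrite -oppr_eq0 => /eqP.
Qed.

Lemma moves_fiber_sub (R C m : nat) (A : 'M[int]_(m, R * C)) t x y :
  fiber A t x -> fiber A t y -> moves A (x - y).
Proof.
by move=> [_ xt] [_ yt]; rewrite /moves /= tvecB mulmxBr xt yt subrr.
Qed.

Lemma fiber_add_move (R C m : nat) (A : 'M[int]_(m, R * C)) t x z :
  fiber A t x -> moves A z -> x + z \is a mxOver Num.nat -> fiber A t (x + z).
Proof.
by move=> [_ xt] z0 xz; split; rewrite // tvecD mulmxDr xt z0 addr0.
Qed.

Lemma basic_movesN (R C : nat) (z : 'M[int]_(R, C)) :
  basic_moves z -> basic_moves (- z).
Proof.
move=> [i [i' [j [j' [ii' jj' ->]]]]]; exists i', i, j, j'; split=> //.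
  by rewrite eq_sym.
by apply/matrixP => k l; rewrite !mxE; ring.
Qed.

Lemma finite_basic_moves (R C : nat) : finite_set (@basic_moves R C).
Proof.
pose f (p : 'I_R * 'I_R * ('I_C * 'I_C)) : 'M[int]_(R, C) :=
  basic_move p.1.1 p.1.2 p.2.1 p.2.2.
apply: sub_finite_set (finite_image f (finite_finset (X := setT))).
by move=> z [i [i' [j [j' [_ _ ->]]]]]; exists (i, i', (j, j')).
Qed.

(** * Walks through nonnegative tables *)

(** Nonnegativity is asked of the end of each step only; that of the start is supplied where it
    matters. If the steps are moves, the walk stays in the fiber of its start. *)
Inductive reach (R C : nat) (B : set 'M[int]_(R, C)) (x : 'M[int]_(R, C)) :
    'M[int]_(R, C) -> Prop :=
| reach_refl : reach B x x
| reach_step y z : reach B x y -> B z -> y + z \is a mxOver Num.nat ->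
    reach B x (y + z).

Lemma reach_trans (R C : nat) (B : set 'M[int]_(R, C)) x y w :
  reach B x y -> reach B y w -> reach B x w.
Proof.
by move=> xy; elim=> // v z _ xv Bz vz; apply: reach_step.
Qed.

Lemma reach_nat (R C : nat) (B : set 'M[int]_(R, C)) x y :
  x \is a mxOver Num.nat -> reach B x y -> y \is a mxOver Num.nat.
Proof. by move=> x0; case. Qed.

Lemma reach_sym (R C : nat) (B : set 'M[int]_(R, C)) x y :
  sign_invariant B -> x \is a mxOver Num.nat -> reach B x y -> reach B y x.
Proof.
move=> BN x0; elim=> [|v z xv vx Bz vz]; first exact: reach_refl.
apply: reach_trans vx; rewrite -{2}(addrK z v).
apply: reach_step; [exact: reach_refl | exact: BN |].
by rewrite addrK; apply: reach_nat xv.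
Qed.

Lemma reach_moves (R C m : nat) (A : 'M[int]_(m, R * C)) B x y t :
  (B `<=` moves A)%classic -> fiber A t x -> reach B x y -> fiber A t y.
Proof.
move=> BA xt; elim=> // v z _ vt Bz vz.
exact: fiber_add_move (BA _ Bz) vz.
Qed.

(** The length [U] may be zero here, for the empty walk. *)
Lemma reach_path (R C m : nat) (A : 'M[int]_(m, R * C)) B x y t :
  (B `<=` moves A)%classic -> fiber A t x -> reach B x y ->
  exists (U : nat) (z : nat -> 'M[int]_(R, C)),
    [/\ forall s, (1 <= s <= U)%N -> B (z s),
        y = x + \sum_(1 <= s < U.+1) z s &
        forall u, (1 <= u <= U)%N ->
          fiber A t (x + \sum_(1 <= s < u.+1) z s)].
Proof.
move=> BA xt; elim=> [|v z xv [U [f [Bf ev ft]]] Bz vz].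
  exists 0%N, (fun=> 0); split=> [s||u]; rewrite ?big_nil ?addr0 //; lia.
pose g s := if s == U.+1 then z else f s.
have gf u : (u <= U)%N -> \sum_(1 <= s < u.+1) g s = \sum_(1 <= s < u.+1) f s.
  move=> uU; apply: eq_big_nat => s su; rewrite /g.
  by case: eqP => // es; lia.
have eU : v + z = x + \sum_(1 <= s < U.+2) g s.
  by rewrite big_nat_recr //= gf // /g eqxx addrA -ev.
exists U.+1, g; split=> // [s sU|u uU].
  rewrite /g; case: eqP => // sU1; apply: Bf; lia.
have [->|uU1] := eqVneq u U.+1.
  by rewrite -eU; apply: fiber_add_move (BA _ Bz) vz; apply: reach_moves xv.
by rewrite gf; [apply: ft|]; lia.
Qed.

(** * Ordering rows and columns by level *)

(** Since [i < n], this number encodes the lexicographic order by level [f i], then by index. *)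
Definition key (n : nat) (f : 'I_n -> nat) (i : 'I_n) : nat := (f i * n + i)%N.

Lemma lt_key (n : nat) (f : 'I_n -> nat) i i' :
  (f i < f i')%N -> (key f i < key f i')%N.
Proof.
move=> ii'; have := ltn_ord i; rewrite /key.
by have := leq_mul ii' (leqnn n); rewrite mulSn; lia.
Qed.

(** The level is the quotient of the key by [n], so an initial segment of keys consists of full
    levels and a part of the single level [p %/ n]. *)
Lemma key_lt_divn (n : nat) (f : 'I_n -> nat) (p : nat) i :
  (key f i < p)%N =
  (f i < p %/ n)%N || ((f i == p %/ n)%N && (key f i < p)%N).
Proof.
have n0 : (0 < n)%N by apply: leq_ltn_trans (ltn_ord i).
have [ip|ip|_] := ltngtP (f i) (p %/ n)%N; rewrite //= /key.
- have := leq_mul ip (leqnn n); have := ltn_ord i.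
  by rewrite mulSn; have := leq_divM p n; lia.
- have := leq_mul ip (leqnn n); have := ltn_ceil p n0.
  by rewrite mulSn; lia.
Qed.

Lemma key_inj (n : nat) (f : 'I_n -> nat) : injective (key f).
Proof.
move=> i i' ii'; apply/val_inj => /=.
have := @lt_key _ f i i'; have := @lt_key _ f i' i; move: ii'; rewrite /key.
by case: (ltngtP (f i) (f i')) => [||->]; lia.
Qed.

(** * Reduced tables and their uniqueness in a fiber *)

Definition exchangeable (R C : nat) (r : 'I_R -> nat) (c : 'I_C -> nat)
    (i i' : 'I_R) (j j' : 'I_C) : Prop :=
  forall n, (r i < n)%N = (r i' < n)%N \/ (c j < n)%N = (c j' < n)%N.

(** The amount by which subtracting the basic move lowers the sum of [key r i * key c j * x i j]; it
    is positive exactly when rows and columns are ordered in the same sense. *)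
Definition key_gain (R C : nat) (r : 'I_R -> nat) (c : 'I_C -> nat)
    (i i' : 'I_R) (j j' : 'I_C) : int :=
  ((key r i')%:Z - (key r i)%:Z) * ((key c j')%:Z - (key c j)%:Z).

Definition reduced (R C : nat) (r : 'I_R -> nat) (c : 'I_C -> nat)
    (x : 'M[int]_(R, C)) : Prop :=
  forall i i' j j', exchangeable r c i i' j j' -> 0 < key_gain r c i i' j j' ->
    x i j = 0 \/ x i' j' = 0.

Lemma key_gain_pos (R C : nat) (r : 'I_R -> nat) (c : 'I_C -> nat) i i' j j' :
  (key r i < key r i')%N -> (key c j < key c j')%N ->
  0 < key_gain r c i i' j j'.
Proof. by move=> ii' jj'; apply: mulr_gt0; lia. Qed.

Lemma reduced_tr (R C : nat) (r : 'I_R -> nat) (c : 'I_C -> nat)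
    (x : 'M[int]_(R, C)) :
  reduced r c x -> reduced c r x^T.
Proof.
move=> xred i i' j j' ex gain; rewrite !mxE; apply: xred.
  by move=> n; case: (ex n); [right | left].
by rewrite /key_gain mulrC.
Qed.

(* In a reduced table [P, p] x [Q, ~ q] or [P, ~ p] x [Q, q] vanishes, so the
   sum over [P, p] x [Q, q] is the minimum of those over [P, p] x Q and
   P x [Q, q]. *)
Lemma reduced_corner (R C : nat) (r : 'I_R -> nat) (c : 'I_C -> nat)
    (x y : 'M[int]_(R, C)) (P p : pred 'I_R) (Q q : pred 'I_C) :
  x \is a mxOver Num.nat -> y \is a mxOver Num.nat ->
  reduced r c x -> reduced r c y ->
  (forall i i' j j', P i -> p i -> P i' -> ~~ p i' ->
     Q j -> ~~ q j -> Q j' -> q j' ->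
     exchangeable r c i i' j j' /\ 0 < key_gain r c i i' j j') ->
  bsum (x - y) (predI P p) Q = 0 -> bsum (x - y) P (predI Q q) = 0 ->
  bsum (x - y) (predI P p) (predI Q q) = 0.
Proof.
move=> x0 y0 xred yred cross.
have split1 z : bsum z (predI P p) Q =
    bsum z (predI P p) (predI Q q) + bsum z (predI P p) (predI Q (predC q)).
  by apply: bsum_split => i j /=; lia.
have split2 z : bsum z P (predI Q q) =
    bsum z (predI P p) (predI Q q) + bsum z (predI P (predC p)) (predI Q q).
  by apply: bsum_split => i j /=; lia.
have empty z : reduced r c z ->
    bsum z (predI P p) (predI Q (predC q)) = 0 \/
    bsum z (predI P (predC p)) (predI Q q) = 0.
  move=> zred; have [|[i [j [/andP[Pi pi] /andP[Qj qj] zij]]]] :=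
    bsum_eq0_or_pos z (predI P p) (predI Q (predC q)); first by left.
  have [|[i' [j' [/andP[Pi' pi'] /andP[Qj' qj'] zij']]]] :=
    bsum_eq0_or_pos z (predI P (predC p)) (predI Q q); first by right.
  have [ex gain] := cross _ _ _ _ Pi pi Pi' pi' Qj qj Qj' qj'.
  by case: (zred _ _ _ _ ex gain) => z0; [case/eqP: zij | case/eqP: zij'].
rewrite !bsumB !split1 !split2.
have := bsum_ge0 (predI P p) (predI Q (predC q)) x0.
have := bsum_ge0 (predI P (predC p)) (predI Q q) x0.
have := bsum_ge0 (predI P p) (predI Q (predC q)) y0.
have := bsum_ge0 (predI P (predC p)) (predI Q q) y0.
by have := empty _ xred; have := empty _ yred; lia.
Qed.

(** Induction on [b], starting from the square [b = a]. Since row sums vanish, a block may be traded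
    for the one on the complementary columns, to which the corner argument applies. *)
Lemma reduced_upper_level (R C : nat) (r : 'I_R -> nat) (c : 'I_C -> nat)
    (x y : 'M[int]_(R, C)) (a b : nat) :
  x \is a mxOver Num.nat -> y \is a mxOver Num.nat ->
  reduced r c x -> reduced r c y ->
  (forall P, bsum (x - y) P predT = 0) ->
  (forall Q, bsum (x - y) predT Q = 0) ->
  (forall n, bsum (x - y) (fun i => r i < n)%N (fun j => c j < n)%N = 0) ->
  (a <= b)%N ->
  bsum (x - y) (fun i => r i < a)%N (fun j => c j < b)%N = 0.
Proof.
move=> x0 y0 xred yred row0 col0 sq0 ab.
have cocol a1 b1 : bsum (x - y) (fun i => r i < a1)%N predT =
    bsum (x - y) (fun i => r i < a1)%N (fun j => c j < b1)%N +
    bsum (x - y) (fun i => r i < a1)%N (fun j => b1 <= c j)%N.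
  by apply: bsum_split => i j /=; lia.
rewrite -(subnKC ab); elim: (b - a)%N => [|k IH]; first by rewrite addn0.
rewrite addnS; set d := (a + k)%N in IH *.
have := cocol a d.+1; rewrite row0 => /esym/eqP; rewrite addr_eq0 => /eqP ->.
apply/eqP; rewrite oppr_eq0; apply/eqP.
(* Rows of level at most [d] are separated only by thresholds at most [d], columns of level at least
   [d] only by thresholds above [d]; hence all these pairs are exchangeable. *)
rewrite -(@reduced_corner _ _ r c x y (fun i => r i < d.+1)%N
  (fun i => r i < a)%N (fun j => d <= c j)%N (fun j => d < c j)%N) //.
- by apply: eq_bsum => i j /=; lia.
- move=> i i' j j' /= ? ? ? ? ? ? ? ?; split; first by move=> n; lia.
  by apply: key_gain_pos; apply: lt_key; lia.
- transitivity (bsum (x - y) (fun i => r i < a)%N (fun j => d <= c j)%N).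
    by apply: eq_bsum => i j /=; lia.
  by have := cocol a d; rewrite row0 IH add0r.
- transitivity (bsum (x - y) (fun i => r i < d.+1)%N (fun j => d.+1 <= c j)%N).
    by apply: eq_bsum => i j /=; lia.
  by have := cocol d.+1 d.+1; rewrite row0 sq0 add0r.
Qed.

(** The case [b <= a] follows from the other one by transposition. *)
Lemma reduced_level (R C : nat) (r : 'I_R -> nat) (c : 'I_C -> nat)
    (x y : 'M[int]_(R, C)) (a b : nat) :
  x \is a mxOver Num.nat -> y \is a mxOver Num.nat ->
  reduced r c x -> reduced r c y ->
  (forall P, bsum (x - y) P predT = 0) ->
  (forall Q, bsum (x - y) predT Q = 0) ->
  (forall n, bsum (x - y) (fun i => r i < n)%N (fun j => c j < n)%N = 0) ->
  bsum (x - y) (fun i => r i < a)%N (fun j => c j < b)%N = 0.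
Proof.
move=> x0 y0 xred yred row0 col0 sq0; case: (leqP a b) => [ab|/ltnW ba].
  exact: reduced_upper_level ab.
have trB : x^T - y^T = (x - y)^T by rewrite raddfB.
rewrite -bsum_tr -trB; apply: reduced_upper_level ba; rewrite ?trB.
- by apply/mxOverP => i j; rewrite mxE (mxOverP x0).
- by apply/mxOverP => i j; rewrite mxE (mxOverP y0).
- exact: reduced_tr.
- exact: reduced_tr.
- by move=> P; rewrite bsum_tr.
- by move=> Q; rewrite bsum_tr.
- by move=> n; rewrite bsum_tr.
Qed.

Lemma reduced_unique (R C : nat) (r : 'I_R -> nat) (c : 'I_C -> nat)
    (x y : 'M[int]_(R, C)) :
  x \is a mxOver Num.nat -> y \is a mxOver Num.nat ->
  reduced r c x -> reduced r c y ->
  (forall P, bsum (x - y) P predT = 0) ->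
  (forall Q, bsum (x - y) predT Q = 0) ->
  (forall n, bsum (x - y) (fun i => r i < n)%N (fun j => c j < n)%N = 0) ->
  x = y.
Proof.
move=> x0 y0 xred yred row0 col0 sq0.
have level a b : bsum (x - y) (fun i => r i < a)%N (fun j => c j < b)%N = 0.
  exact: reduced_level.
(* Beyond full levels, only the part of row level [a] with key below [p] is left to treat. *)
have rowkey p b :
    bsum (x - y) (fun i => key r i < p)%N (fun j => c j < b)%N = 0.
  pose a := (p %/ R)%N.
  rewrite (@bsum_split _ _ _ _ _ (fun i => r i < a)%N (fun j => c j < b)%N
    (fun i => (r i == a) && (key r i < p))%N (fun j => c j < b)%N); last first.
    by move=> i j; rewrite key_lt_divn -/a; case: ltngtP; lia.
  rewrite level add0r.
  (* A full row level is the difference of two initial segments of levels. *)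
  have eqr : bsum (x - y) (fun i => r i == a) (fun j => b <= c j)%N = 0.
    have s1 : bsum (x - y) (fun i => r i == a) predT =
        bsum (x - y) (fun i => r i == a) (fun j => c j < b)%N +
        bsum (x - y) (fun i => r i == a) (fun j => b <= c j)%N.
      by apply: bsum_split => i j /=; lia.
    have s2 : bsum (x - y) (fun i => r i < a.+1)%N (fun j => c j < b)%N =
        bsum (x - y) (fun i => r i < a)%N (fun j => c j < b)%N +
        bsum (x - y) (fun i => r i == a) (fun j => c j < b)%N.
      by apply: bsum_split => i j /=; lia.
    by move: s1 s2; rewrite row0 !level; lia.
  have s : bsum (x - y) (fun i => (r i == a) && (key r i < p))%N predT =
      bsum (x - y) (fun i => (r i == a) && (key r i < p))%N (fun j => c j < b)%N
      + bsum (x - y) (fun i => (r i == a) && (key r i < p))%N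
          (fun j => b <= c j)%N.
    by apply: bsum_split => i j /=; lia.
  (* Two rows of level [a] are separated by no threshold, so they are exchangeable with any two
     columns. *)
  have := @reduced_corner _ _ r c x y (fun i => r i == a)
    (fun i => key r i < p)%N predT (fun j => b <= c j)%N x0 y0 xred yred.
  move: s; rewrite !row0 => s corner; move: s.
  rewrite corner //; first by lia.
  move=> i i' j j' /= ? ? ? ? ? ? ? ?; split; first by move=> n; lia.
  by apply: key_gain_pos; [lia | apply: lt_key; lia].
have bothkey p q :
    bsum (x - y) (fun i => key r i < p)%N (fun j => key c j < q)%N = 0.
  pose b := (q %/ C)%N.
  rewrite (@bsum_split _ _ _ _ _ (fun i => key r i < p)%N (fun j => c j < b)%N
    (fun i => key r i < p)%N (fun j => (c j == b) && (key c j < q))%N);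
    last first.
    by move=> i j; rewrite (key_lt_divn c) -/b; case: (ltngtP (c j)); lia.
  rewrite rowkey add0r.
  have eqc : bsum (x - y) (fun i => key r i < p)%N (fun j => c j == b) = 0.
    have s : bsum (x - y) (fun i => key r i < p)%N (fun j => c j < b.+1)%N =
        bsum (x - y) (fun i => key r i < p)%N (fun j => c j < b)%N +
        bsum (x - y) (fun i => key r i < p)%N (fun j => c j == b).
      by apply: bsum_split => i j /=; lia.
    by move: s; rewrite !rowkey; lia.
  have s : bsum (x - y) (fun i => key r i < p)%N (fun j => c j == b) =
      bsum (x - y) (fun i => key r i < p)%N
        (fun j => (c j == b) && (key c j < q))%N +
      bsum (x - y) (fun i => key r i < p)%N
        (fun j => (c j == b) && (q <= key c j))%N.
    by apply: bsum_split => i j /=; lia.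
  (* Now the two columns have the same level [b], so the rows may be arbitrary and can be cut by
     key. *)
  have := @reduced_corner _ _ r c x y predT (fun i => key r i < p)%N
    (fun j => c j == b) (fun j => q <= key c j)%N x0 y0 xred yred.
  move: s; rewrite eqc col0 => s corner; move: s.
  rewrite corner //; first by lia.
  move=> i i' j j' /= ? ? ? ? ? ? ? ?; split; first by move=> n; lia.
  by apply: key_gain_pos; lia.
apply/matrixP => i j; apply/eqP; rewrite -subr_eq0; apply/eqP.
have -> : x i j - y i j = (x - y) i j by rewrite !mxE.
rewrite -bsum_pred1.
(* Keys are injective, so raising a bound from a key to its successor adds one row or column: an
   entry is a second difference of the sums in [bothkey]. *)
have si : bsum (x - y) (fun i0 => key r i0 < (key r i).+1)%N (pred1 j) =
    bsum (x - y) (fun i0 => key r i0 < key r i)%N (pred1 j) +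
    bsum (x - y) (pred1 i) (pred1 j).
  apply: bsum_split => k l /=.
  by rewrite ltnS leq_eqVlt (inj_eq (@key_inj _ r)); case: eqP => [->|]; lia.
have sj p : bsum (x - y) (fun i => key r i < p)%N
      (fun l => key c l < (key c j).+1)%N =
    bsum (x - y) (fun i => key r i < p)%N (fun l => key c l < key c j)%N +
    bsum (x - y) (fun i => key r i < p)%N (pred1 j).
  apply: bsum_split => k l /=.
  rewrite ltnS [(key c l <= _)%N]leq_eqVlt (inj_eq (@key_inj _ c)).
  by case: eqP => [->|]; lia.
have := sj (key r i); have := sj (key r i).+1; rewrite !bothkey; lia.
Qed.

(** * Reduction by basic moves of the configuration *)

(** If the threshold of [S n] fails to separate the two rows or the two columns, the four indicator
    values cancel in pairs. *)
Lemma moves_basic_move (R C N : nat) (S : 'I_N -> {set 'I_R * 'I_C})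
    (r : 'I_R -> nat) (c : 'I_C -> nat) (i i' : 'I_R) (j j' : 'I_C) :
  (forall n i j, ((i, j) \in S n) = (r i < n.+1)%N && (c j < n.+1)%N) ->
  exchangeable r c i i' j j' -> moves (config S) (basic_move i i' j j').
Proof.
move=> Slevel ex; apply/movesP; split=> [P|Q|n].
- by rewrite /bsum wsum_basic_move; ring.
- by rewrite /bsum wsum_basic_move /=; ring.
rewrite wsum_basic_move !Slevel.
by case: (ex n.+1) => ->; rewrite ?andbF /=; ring.
Qed.

Lemma exists_reduced (R C N : nat) (S : 'I_N -> {set 'I_R * 'I_C})
    (r : 'I_R -> nat) (c : 'I_C -> nat) (x : 'M[int]_(R, C)) :
  (forall n i j, ((i, j) \in S n) = (r i < n.+1)%N && (c j < n.+1)%N) ->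
  x \is a mxOver Num.nat ->
  exists2 x', reduced r c x' &
    reach (basic_moves (R:=R) (C:=C) `&` moves (config S))%classic x x'.
Proof.
move=> Slevel.
pose weight (y : 'M[int]_(R, C)) :=
  wsum y (fun i j => (key r i)%:Z * (key c j)%:Z).
have weight_ge0 y : y \is a mxOver Num.nat -> 0 <= weight y.
  move=> /mxOverP y0; apply: sumr_ge0 => i _; apply: sumr_ge0 => j _.
  by rewrite !mulr_ge0 // -Znat_def.
(* Induction on a strict bound [k] for the weight, which is a nonnegative integer. *)
move: {2}(`|weight x|%N).+1 (leqnn `|weight x|%N.+1) => k.
elim: k x => // k IH x xk x0.
have [xred|] := EM (reduced r c x); first by exists x => //; apply: reach_refl.
move=> /existsNP[i /existsNP[i' /existsNP[j /existsNP[j' ]]]].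
move=> /not_implyP[ex /not_implyP[gain /not_orP[/eqP xij /eqP xij']]].
have ii' : i != i'.
  by apply: contraTneq gain => ->; rewrite /key_gain subrr mul0r.
have jj' : j != j'.
  by apply: contraTneq gain => ->; rewrite /key_gain subrr mulr0.
(* Only the entries at [(i, j)] and [(i', j')] decrease, each by one, and both are positive. *)
have y0 : x + - basic_move i i' j j' \is a mxOver Num.nat.
  apply/mxOverP => k' l; move: (mxOverP x0 k' l) xij xij'.
  move: (mxOverP x0 i j) (mxOverP x0 i' j'); rewrite !Znat_def !mxE.
  have [->|ki] := eqVneq k' i; have [lj|lj] := eqVneq l j;
    rewrite ?lj ?(negPf ii') ?(negPf jj') /=; try lia;
    have [ki'|ki'] := eqVneq k' i'; have [lj'|lj'] := eqVneq l j';
    rewrite ?ki' ?lj' //=; lia.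
have weighty : weight (x + - basic_move i i' j j') =
    weight x - key_gain r c i i' j j'.
  by rewrite /weight wsumD wsumN wsum_basic_move /key_gain; ring.
have [|x' x'red yx'] := IH _ _ y0.
  by have := weight_ge0 _ x0; have := weight_ge0 _ y0; rewrite weighty; lia.
exists x' => //; apply: reach_trans yx'.
apply: reach_step y0; first exact: reach_refl.
split; first by apply: basic_movesN; exists i, i', j, j'.
exact/movesN/(moves_basic_move Slevel ex).
Qed.

(** * Levels of a chain of rectangles *)

Lemma upward_closed_threshold (N : nat) (P : pred 'I_N) :
  (forall m n : 'I_N, (m <= n)%N -> P m -> P n) ->
  exists k, forall n : 'I_N, P n = (k <= n)%N.
Proof.
move=> up; have [n0 Pn0|P0] := pickP P; last first.
  (* The threshold [N] lies above all indices and encodes the empty predicate. *)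
  by exists N => n; rewrite P0 leqNgt ltn_ord.
case: (arg_minnP (fun n : 'I_N => n : nat) Pn0) => k Pk kmin.
by exists k => n; apply/idP/idP => [/kmin | /up]; last apply.
Qed.

(** The level of a row or column is the index of the first rectangle meeting it. Levels suffice
    because a rectangle is the product of its two projections and both grow along the chain. [S n]
    gets threshold [n.+1], leaving threshold 0 for the empty block. *)
Lemma nested_rectangle_levels (R C N : nat) (S : 'I_N -> {set 'I_R * 'I_C}) :
  (forall n, rectangle (S n)) ->
  (forall m n : 'I_N, (m < n)%N -> S m \proper S n) ->
  exists (r : 'I_R -> nat) (c : 'I_C -> nat), forall n i j,
    ((i, j) \in S n) = (r i < n.+1)%N && (c j < n.+1)%N.
Proof.
move=> rect chain.
have mono (m n : 'I_N) p : (m <= n)%N -> p \in S m -> p \in S n.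
  rewrite leq_eqVlt => /predU1P[/val_inj -> //|mn].
  by have /proper_sub/fintype.subsetP := chain _ _ mn; apply.
pose rowS i n := [exists j, (i, j) \in S n].
pose colS j n := [exists i, (i, j) \in S n].
have prodS n i j : ((i, j) \in S n) = rowS i n && colS j n.
  apply/idP/andP => [ijS|[/existsP[j' ]]].
    by split; apply/existsP; [exists j | exists i].
  move=> ijS /existsP[i' ]; move: ijS.
  by have [a1 [a2 [b1 [b2 [_ _ ->]]]]] := rect n; rewrite !inE /=; lia.
have [r rP] : exists r : 'I_R -> nat, forall i n, rowS i n = (r i <= n)%N.
  apply: (@fin_all_exists _ (fun=> nat)
    (fun i k => forall n, rowS i n = (k <= n)%N)) => i.
  apply: upward_closed_threshold => m n mn.
  by move=> /existsP[j jS]; apply/existsP; exists j; apply: mono jS.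
have [c cP] : exists c : 'I_C -> nat, forall j n, colS j n = (c j <= n)%N.
  apply: (@fin_all_exists _ (fun=> nat)
    (fun j k => forall n, colS j n = (k <= n)%N)) => j.
  apply: upward_closed_threshold => m n mn.
  by move=> /existsP[i iS]; apply/existsP; exists i; apply: mono iS.
by exists r, c => n i j; rewrite prodS rP cP !ltnS.
Qed.

(* Truncating the levels at N makes the last level set the whole table, so that
   no bound on n is needed. *)
Lemma moves_level_sum (R C N : nat) (S : 'I_N -> {set 'I_R * 'I_C})
    (r : 'I_R -> nat) (c : 'I_C -> nat) (z : 'M[int]_(R, C)) n :
  (forall n i j, ((i, j) \in S n) = (r i < n.+1)%N && (c j < n.+1)%N) ->
  moves (config S) z ->
  bsum z (fun i => minn (r i) N < n)%N (fun j => minn (c j) N < n)%N = 0.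
Proof.
move=> Slevel /movesP[row0 col0 S0].
case: n => [|n]; first by apply: big1 => i _; apply: big1 => j _; rewrite mulr0.
have [nN|Nn] := ltnP n N.
  rewrite -(S0 (Ordinal nN)); apply: eq_wsum => i j; rewrite Slevel /=.
  by congr (nat_of_bool _)%:R; lia.
by rewrite -(row0 predT); apply: eq_bsum => i j /=; lia.
Qed.

(** * Connectedness of the fibers *)

(** Two tables of a fiber reach the same reduced table; the walk from the first is followed by the
    reverse of the walk from the second. *)
Lemma basic_moves_markov (R C N : nat) (S : 'I_N -> {set 'I_R * 'I_C}) :
  (forall n, rectangle (S n)) ->
  (forall m n : 'I_N, (m < n)%N -> S m \proper S n) ->
  markov_basis (config S)
    (basic_moves (R:=R) (C:=C) `&` moves (config S))%classic.
Proof.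
move=> rect chain; have [r [c level]] := nested_rectangle_levels rect chain.
pose r' i := minn (r i) N; pose c' j := minn (c j) N.
have level' n i j : ((i, j) \in S n) = (r' i < n.+1)%N && (c' j < n.+1)%N.
  by rewrite level /r' /c'; have := ltn_ord n; lia.
set B := (_ `&` _)%classic.
have BS : (B `<=` moves (config S))%classic by move=> z [].
have BN : sign_invariant B.
  by move=> z [bz mz]; split; [apply: basic_movesN | apply: movesN].
split=> // [|t x y xt yt xy].
  exact: finite_setIl (@finite_basic_moves R C).
have x0 := xt.1; have y0 := yt.1.
have [x' x'red xx'] := exists_reduced level' x0.
have [y' y'red yy'] := exists_reduced level' y0.
have x't := reach_moves BS xt xx'; have y't := reach_moves BS yt yy'.
have mz := moves_fiber_sub x't y't; have [row0 col0 _] := (movesP _ _).1 mz.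
have x'y' : x' = y'.
  apply: (reduced_unique x't.1 y't.1 x'red y'red row0 col0) => n.
  exact: moves_level_sum level mz.
have yx : reach B x y.
  by apply: reach_trans xx' _; rewrite x'y'; apply: reach_sym.
have [U [z [Bz ey zt]]] := reach_path BS xt yx.
(* A walk of length zero would give [x = y]. *)
exists U, z; split=> //; case: U ey {Bz zt} => // ey.
by case: xy; rewrite ey big_nil addr0.
Qed.

(** * Indispensability of basic moves, minimality and uniqueness *)

(** Each entry is bounded by its row and column sums, so [v] vanishes off four cells. There it is a
    nonnegative integer two by two table with all margins 1, determined by one entry in {0, 1}. *)
Lemma fiber_two_cells (R C : nat) (v : 'M[int]_(R, C)) (i i' : 'I_R)
    (j j' : 'I_C) :
  i != i' -> j != j' -> v \is a mxOver Num.nat ->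
  (forall P, bsum v P predT = bsum (delta_mx i j + delta_mx i' j') P predT) ->
  (forall Q, bsum v predT Q = bsum (delta_mx i j + delta_mx i' j') predT Q) ->
  v = delta_mx i j + delta_mx i' j' \/ v = delta_mx i' j + delta_mx i j'.
Proof.
move=> ii' jj' v0.
have sumE P Q : bsum (delta_mx i j + delta_mx i' j') P Q =
    (P i && Q j)%:R + (P i' && Q j')%:R.
  by rewrite bsumD /bsum !wsum_delta.
move=> vrow vcol.
have rowv k : bsum v (pred1 k) predT = (i == k)%:R + (i' == k)%:R.
  by rewrite vrow sumE /= !andbT.
have colv l : bsum v predT (pred1 l) = (j == l)%:R + (j' == l)%:R.
  by rewrite vcol sumE.
have vr k l : v k l <= (i == k)%:R + (i' == k)%:R.
  rewrite -rowv (@bsum_split _ _ _ _ _ (pred1 k) (pred1 l) (pred1 k) (predC1 l)).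
    by rewrite bsum_pred1 lerDl bsum_ge0.
  by move=> a b /=; lia.
have vc k l : v k l <= (j == l)%:R + (j' == l)%:R.
  rewrite -colv (@bsum_split _ _ _ _ _ (pred1 k) (pred1 l) (predC1 k) (pred1 l)).
    by rewrite bsum_pred1 lerDl bsum_ge0.
  by move=> a b /=; lia.
have vout k l : ~~ ((k \in pred2 i i') && (l \in pred2 j j')) -> v k l = 0.
  move: (vr k l) (vc k l) (mxOverP v0 k l); rewrite Znat_def !inE.
  by rewrite [k == i]eq_sym [k == i']eq_sym [l == j]eq_sym [l == j']eq_sym; lia.
have row2 k : bsum v (pred1 k) predT = v k j + v k j'.
  rewrite (@bsum_split _ _ _ _ _ (pred1 k) (pred1 j) (pred1 k) (predC1 j));
    last by move=> a b /=; lia.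
  rewrite (@bsum_split _ _ v (pred1 k) (predC1 j) (pred1 k) (pred1 j')
    (pred1 k) (predC (pred2 j j'))); last first.
    by move=> a b /=; have [->|] := eqVneq b j'; rewrite ?[j' == j]eq_sym; lia.
  rewrite !bsum_pred1; have [->|[a [b [_ bjj' /eqP[]]]]] :=
    bsum_eq0_or_pos v (pred1 k) (predC (pred2 j j')); first by rewrite addr0.
  by apply: vout; rewrite negb_and; apply/orP; right.
have col2 l : bsum v predT (pred1 l) = v i l + v i' l.
  rewrite (@bsum_split _ _ _ _ _ (pred1 i) (pred1 l) (predC1 i) (pred1 l));
    last by move=> a b /=; lia.
  rewrite (@bsum_split _ _ v (predC1 i) (pred1 l) (pred1 i') (pred1 l)
    (predC (pred2 i i')) (pred1 l)); last first.
    by move=> a b /=; have [->|] := eqVneq a i'; rewrite ?[i' == i]eq_sym; lia.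
  rewrite !bsum_pred1; have [->|[a [b [aii' _ /eqP[]]]]] :=
    bsum_eq0_or_pos v (predC (pred2 i i')) (pred1 l); first by rewrite addr0.
  by apply: vout; rewrite negb_and; apply/orP; left.
have := (row2 i, row2 i', col2 j); rewrite !rowv !colv !eqxx.
rewrite [i' == i]eq_sym [j' == j]eq_sym (negPf ii') (negPf jj').
have := (mxOverP v0 i j, mxOverP v0 i j', mxOverP v0 i' j).
rewrite !Znat_def => -[[vij0 vij'0] vi'j0] [[ri ri'] cj].
have vE (w : 'M[int]_(R, C)) :
    (forall k l, ~~ ((k \in pred2 i i') && (l \in pred2 j j')) -> w k l = 0) ->
    w i j = v i j -> w i' j' = v i' j' -> w i' j = v i' j -> w i j' = v i j' ->
    v = w.
  move=> wout w1 w2 w3 w4; apply/matrixP => k l.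
  have [/andP[]|out] := boolP ((k \in pred2 i i') && (l \in pred2 j j')).
    by rewrite !inE => /orP[]/eqP-> /orP[]/eqP->.
  by rewrite vout ?wout.
have [v1|v1] : v i j = 1 \/ v i j = 0 by lia.
- left; apply: vE => [k l||||]; rewrite !mxE ?inE ?eqxx ?(eq_sym i' i)
    ?(eq_sym j' j) ?(negPf ii') ?(negPf jj') //=; lia.
- right; apply: vE => [k l||||]; rewrite !mxE ?inE ?eqxx ?(eq_sym i' i)
    ?(eq_sym j' j) ?(negPf ii') ?(negPf jj') //=; lia.
Qed.

(** A walk from the negative part [x] of [w] to its positive part [y] has only these two tables to
    visit, so the step by which it leaves [x] is [w]. *)
Lemma basic_move_indispensable (R C N : nat) (S : 'I_N -> {set 'I_R * 'I_C})
    (B : set 'M[int]_(R, C)) :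
  markov_basis (config S) B ->
  (basic_moves (R:=R) (C:=C) `&` moves (config S) `<=` B)%classic.
Proof.
move=> [BS _ _ conn] w [[i [i' [j [j' [ii' jj' ew]]]]] mw].
apply: contrapT => nBw.
pose y : 'M[int]_(R, C) := delta_mx i j + delta_mx i' j'.
pose x : 'M[int]_(R, C) := delta_mx i' j + delta_mx i j'.
have {}ew : w = y - x by rewrite ew opprD addrA.
have deltaD0 (k k' : 'I_R) (l l' : 'I_C) :
    delta_mx k l + delta_mx k' l' \is a mxOver Num.nat.
  by apply/mxOverP => a b; rewrite !mxE rpredD // natr_nat.
have yt : fiber (config S) (config S *m tvec x) y.
  split; first exact: deltaD0.
  by apply/eqP; rewrite -subr_eq0 -mulmxBr -tvecB -ew; apply/eqP.
have xt : fiber (config S) (config S *m tvec x) x.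
  by split; first exact: deltaD0.
have xy : x <> y.
  move=> /matrixP/(_ i j)/eqP; rewrite !mxE !eqxx.
  by rewrite (negPf ii') (negPf jj').
have [U [z [U0 Bz ey zt]]] := conn _ _ _ xt yt xy.
have two v : fiber (config S) (config S *m tvec x) v -> v = y \/ v = x.
  move=> vt; have /movesP[row0 col0 _] := moves_fiber_sub vt yt.
  apply: fiber_two_cells => //; first exact: vt.1.
    by move=> P; apply/eqP; rewrite -subr_eq0 -bsumB row0.
  by move=> Q; apply/eqP; rewrite -subr_eq0 -bsumB col0.
have stay u : (u <= U)%N -> x + \sum_(1 <= s < u.+1) z s = x.
  elim: u => [|u IH] uU; first by rewrite big_nil addr0.
  have [|//] := two _ (zt u.+1 uU).
  rewrite big_nat_recr //= addrA (IH (ltnW uU)) => exz.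
  case: nBw; have <- : z u.+1 = w by rewrite ew -exz [RHS]addrC addKr.
  exact: Bz.
by apply: xy; rewrite ey stay.
Qed.

Theorem theorem1 (R C N : nat) (S : 'I_N -> {set 'I_R * 'I_C})
    (hR : (1 <= R)%N) (hC : (1 <= C)%N) (hN : (1 <= N)%N)
    (hrect : forall n : 'I_N, rectangle (S n))
    (hchain : forall m n : 'I_N, (m < n)%N -> S m \proper S n)
    (hproper : forall n : 'I_N, S n \proper [set: 'I_R * 'I_C]%SET) :
  minimal_markov_basis (config S)
    (basic_moves (R:=R) (C:=C) `&` moves (config S))%classic /\
  (forall B : set 'M[int]_(R, C), minimal_markov_basis (config S) B ->
     B = (basic_moves (R:=R) (C:=C) `&` moves (config S))%classic).
Proof.
have markovS := basic_moves_markov hrect hchain.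
split; first split=> // B' [_ nsub] _ markovB'.
  by apply: nsub; apply: basic_move_indispensable markovB'.
(* A minimal basis contains the basic moves of the configuration; were the inclusion proper, they
   would be a smaller Markov basis. *)
move=> B [markovB minB]; have subB := basic_move_indispensable markovB.
apply/seteqP; split=> //; apply: contrapT => nsub.
by case: markovS => ? ? sinv ?; apply: (minB _ _ sinv).
Qed.
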